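(* (a) A left or right group-$e$-semigroup $(G,\cdot,e,\odot)$ is identical if and only if $(G,\odot)$ is an $f$-grouplike. (b) Suppose $(S,\cdot,e,\odot)$ is a left or right monoid-$e$-semigroup. Then $S$ is a left identical monoid-$e$-semigroup if and only if $\odot$ is an $f$-multiplication, i.e. $\odot=\cdot_f$ for some function $f:S\to S$ (and of course such $f$ is unique, namely the left $e$-map $J_e$, $J_e(x)=e\odot x$).
   Context: A left (resp. right) monoid-$e$-semigroup $(S,\cdot,e,\odot)$ consists of a monoid $(S,\cdot)$ with identity element $e$ and a semigroup $(S,\odot)$ on the same set such that $e\odot(xy)=e\odot(x\odot y)$ (resp. $(xy)\odot e=(x\odot y)\odot e$) for all $x,y\in S$ (where $xy=x\cdot y$). It is a left (resp. right) group-$e$-semigroup if $(S,\cdot)$ is a group. It is left identical if $e\odot(xy)=e\odot(x\odot y)=x\odot y$ for all $x,y\in S$, and right identical if $(xy)\odot e=(x\odot y)\odot e=x\odot y$ for all $x,y\in S$; a left (resp. right) group-$e$-semigroup is called identical if it is left (resp. right) identical. For monoid-$e$-semigroups each of the left, right and two-sided identical conditions implies the others. For $f:S\to S$, the $f$-multiplication of $\cdot$ is $x\cdot_f y:=f(xy)$. A homogroup is a semigroup containing an ideal subgroup; a grouplike is a homogroup with exactly one central idempotent. A grouplike $(\Gamma,\bullet)$ is an $f$-grouplike if there exist a group $(G',\cdot)$ and an associative function $f:G'\to G'$ (i.e. $f(xf(yz))=f(f(xy)z)$ for all $x,y,z$) such that $(\Gamma,\bullet)=(G',\cdot_f)$.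 *)

(* Defs.v *)
From mathcomp Require Import all_boot.

Set Implicit Arguments.
Unset Strict Implicit.
Unset Printing Implicit Defensive.

(* The structures below carry two operations on one arbitrary set, so they are
   predicates on operations over a bare [T : Type]; MathComp's [monoidType] and
   [groupType] would also impose a choice structure on the carrier. *)

Section Structures.
Variable T : Type.
Implicit Types (mul odot op : T -> T -> T) (e z : T) (f : T -> T).
Implicit Types K : T -> Prop.

Definition is_monoid mul e :=
  [/\ associative mul, left_id e mul & right_id e mul].

Definition is_group mul e :=
  is_monoid mul e /\ forall x, exists y, mul y x = e /\ mul x y = e.

Definition left_monoid_e_semigroup mul e odot :=
  [/\ is_monoid mul e, associative odot
    & forall x y, odot e (mul x y) = odot e (odot x y)].

Definition right_monoid_e_semigroup mul e odot :=
  [/\ is_monoid mul e, associative odot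
    & forall x y, odot (mul x y) e = odot (odot x y) e].

Definition left_group_e_semigroup mul e odot :=
  is_group mul e /\ left_monoid_e_semigroup mul e odot.

Definition right_group_e_semigroup mul e odot :=
  is_group mul e /\ right_monoid_e_semigroup mul e odot.

Definition left_identical mul e odot := forall x y,
  odot e (mul x y) = odot e (odot x y) /\ odot e (odot x y) = odot x y.

Definition right_identical mul e odot := forall x y,
  odot (mul x y) e = odot (odot x y) e /\ odot (odot x y) e = odot x y.

Definition f_mul mul f : T -> T -> T := fun x y => f (mul x y).

Definition left_e_map odot e : T -> T := fun x => odot e x.

Definition associative_map mul f := forall x y z,
  f (mul x (f (mul y z))) = f (mul (f (mul x y)) z).

Definition is_ideal op K := forall x k, K k -> K (op x k) /\ K (op k x).

(* [K] is a group for the restriction of the associative operation [op]; its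
   identity [z] need not be an identity of the ambient semigroup. *)
Definition is_subgroup op K :=
  (forall x y, K x -> K y -> K (op x y)) /\
  exists z, [/\ K z, forall x, K x -> op z x = x /\ op x z = x
    & forall x, K x -> exists y, [/\ K y, op y x = z & op x y = z]].

Definition is_homogroup op :=
  associative op /\ exists K, is_ideal op K /\ is_subgroup op K.

Definition central_idempotent op z :=
  op z z = z /\ forall x, op z x = op x z.

Definition is_grouplike op :=
  is_homogroup op /\ exists! z, central_idempotent op z.

(* The group operation [mul] is any one on the carrier, in general unrelated
   to the group operation of an ambient group-e-semigroup. *)
Definition is_f_grouplike op :=
  is_grouplike op /\
  exists mul e f,
    [/\ is_group mul e, associative_map mul f & op =2 f_mul mul f].

End Structures.

(* Main.v *)
(** The implications from identical to [f]-grouplike: if [odot = f_mul mul f]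
    with [f \o f = f], associativity makes [f] a surjective homomorphism from
    the group [mul] onto its image, an ideal subgroup that contains all
    idempotents of [odot].  Conversely, if [odot x y] depends only on the
    product of [x] and [y] in some group, then every [odot x y] equals some
    [odot t k] with [k] in the ideal subgroup [K], so all products lie in [K].
    With [z] the identity of [K], the cubic relation
    [odot e e = odot e (odot e e)] gives [w w = w w w] in the group [K] for
    [w = odot e z]; hence [w = z], so [e] acts as the identity on [K]. *)

Require Import Defs.
From mathcomp Require Import all_boot.

Set Implicit Arguments.
Unset Strict Implicit.
Unset Printing Implicit Defensive.

Section FMultiplication.
Variables (T : Type) (mul : T -> T -> T) (e : T) (odot : T -> T -> T).
Variable f : T -> T.
Hypotheses (mulM : is_monoid mul e) (odotE : odot =2 f_mul mul f).

Lemma f_mul_1l x : odot e x = f x.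
Proof. by case: mulM => _ mul1 _; rewrite odotE /f_mul mul1. Qed.

Lemma f_mul_1r x : odot x e = f x.
Proof. by case: mulM => _ _ mulr1; rewrite odotE /f_mul mulr1. Qed.

Lemma f_mul_assoc_map : associative odot -> associative_map mul f.
Proof. by move=> odotA x y z; have := odotA x y z; rewrite !odotE. Qed.

Hypotheses (odotA : associative odot) (f_idem : forall x, f (f x) = f x).

(** Since [f y] is [odot y e], associativity moves the inner [f] outside the product, where
    idempotence absorbs it. *)
Lemma f_mul_fr x y : odot x (f y) = odot x y.
Proof. by rewrite -f_mul_1r odotA f_mul_1r odotE f_idem. Qed.

Lemma f_mul_fl x y : odot (f x) y = odot x y.
Proof. by rewrite -f_mul_1l -odotA f_mul_1l odotE f_idem. Qed.

End FMultiplication.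

Lemma idempotent_f_mul_f_grouplike T (mul : T -> T -> T) e odot f :
    is_group mul e -> associative odot -> odot =2 f_mul mul f ->
    (forall x, f (f x) = f x) ->
  is_f_grouplike odot.
Proof.
move=> mulG odotA odotE f_idem.
have [mulM mulV] := mulG; have [mulA mul1 mulr1] := mulM.
have fr := f_mul_fr mulM odotE odotA f_idem.
have fl := f_mul_fl mulM odotE odotA f_idem.
have o1l := f_mul_1l mulM odotE; have o1r := f_mul_1r mulM odotE.
split; last by exists mul, e, f; split=> //; apply: f_mul_assoc_map odotE odotA.
split.
  split=> //; exists (fun k => exists x, k = f x); split.
    by move=> x k _; split; [exists (mul x k) | exists (mul k x)]; apply: odotE.
  split; first by move=> x y _ _; exists (mul x y); apply: odotE.
  exists (f e); split; first by exists e.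
    by move=> _ [x ->]; rewrite !fl !fr o1l o1r.
  move=> _ [x ->]; have [y [yx xy]] := mulV x.
  by exists (f y); split; [by exists y | |]; rewrite fl fr odotE /f_mul ?yx ?xy.
exists (f e); split.
  by split=> [|x]; rewrite fl ?fr o1l // o1r.
(* With [y] the [mul]-inverse of [z], [odot y z] is [f e]. Right multiplication by the idempotent
   [z] fixes this element, yet sends it to [f z = z]. *)
move=> z [zz _]; have [y [yz _]] := mulV z.
have fz : f z = z by rewrite -zz odotE f_idem.
have: odot (odot y z) z = odot y z by rewrite -odotA zz.
have -> : odot y z = f e by rewrite odotE /f_mul yz.
by rewrite fl o1l fz.
Qed.

Lemma subgroup_idem T (op : T -> T -> T) K z w :
    associative op -> (forall x, K x -> op z x = x /\ op x z = x) ->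
    (forall x, K x -> exists y, [/\ K y, op y x = z & op x y = z]) ->
  K w -> op w w = w -> w = z.
Proof.
move=> opA K1 KV Kw ww; have [y [_ yw _]] := KV w Kw.
by rewrite -yw -{2}ww opA yw (K1 w Kw).1.
Qed.

(** The ideal [K] contains both [op x z] and [op z x], so each equals [op (op z x) z]. *)
Lemma ideal_subgroup_central T (op : T -> T -> T) K z :
    is_ideal op K -> associative op -> K z ->
    (forall x, K x -> op z x = x /\ op x z = x) ->
  forall x, op z x = op x z.
Proof.
move=> KI opA Kz K1 x; have [Kxz Kzx] := KI x z Kz.
by rewrite -(K1 _ Kxz).1 opA (K1 _ Kzx).2.
Qed.

Lemma f_grouplike_cubic_identity T (odot : T -> T -> T) e :
    is_f_grouplike odot -> odot e e = odot e (odot e e) ->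
  forall x y, odot e (odot x y) = odot x y /\ odot (odot x y) e = odot x y.
Proof.
case=> [[[odotA [K [KI [KM [z [Kz K1 KV]]]]]] _] [mul [u [f [mulG _ odotE]]]]].
have [[mulA mul1 mulr1] mulV] := mulG.
(* Let [z'] be the [mul]-inverse of [z]. As [odot] sees only the [mul]-product, the last factor can
   be made [z], and the ideal [K] absorbs the rest. *)
have Kodot x y : K (odot x y).
  have [z' [z'z _]] := mulV z.
  have -> : odot x y = odot (mul (mul x y) z') z.
    by rewrite !odotE /f_mul -mulA z'z mulr1.
  exact: (KI _ z Kz).1.
have zC := ideal_subgroup_central KI odotA Kz K1.
move=> eee; set w := odot e z.
have Kw : K w by apply: Kodot.
have wE k : K k -> odot w k = odot e k.
  by move=> Kk; rewrite /w -odotA (K1 k Kk).1.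
(* On [K], left multiplication by [w] agrees with that by [e], so this is the cubic relation for [e]
   multiplied by [z]. *)
have www : odot w (odot w w) = odot w w.
  rewrite !wE //; rewrite /w.
  by rewrite (odotA e e z) (odotA e _ z) -eee.
have ww : odot w w = w.
  have [y [_ yw _]] := KV w Kw.
  have: odot y (odot w (odot w w)) = odot y (odot w w) by rewrite www.
  by rewrite (odotA y w (odot w w)) (odotA y w w) yw !(K1 _ _).1.
have wz : w = z by apply: subgroup_idem odotA K1 KV Kw ww.
(* Insert [z] next to [odot x y]: it meets [e] and forms [w = z], on the right after commuting [z]
   with [e]. *)
move=> x y; have [zxy xyz] := K1 _ (Kodot x y); split.
  by rewrite -[in LHS]zxy odotA -/w wz.
by rewrite -[in LHS]xyz -odotA zC -/w wz.
Qed.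

Lemma identical_left_f_mul T (mul : T -> T -> T) e odot :
  left_identical mul e odot -> odot =2 f_mul mul (left_e_map odot e).
Proof.
by move=> idl x y; have [h1 h2] := idl x y; rewrite /f_mul /left_e_map h1 h2.
Qed.

Lemma identical_right_f_mul T (mul : T -> T -> T) e odot :
  right_identical mul e odot -> odot =2 f_mul mul (odot^~ e).
Proof. by move=> idr x y; have [h1 h2] := idr x y; rewrite /f_mul h1 h2. Qed.

Theorem corollary3p5 (T : Type) (mul : T -> T -> T) (e : T)
    (odot : T -> T -> T) :
  ((left_group_e_semigroup mul e odot ->
      (left_identical mul e odot <-> is_f_grouplike odot)) /\
   (right_group_e_semigroup mul e odot ->
      (right_identical mul e odot <-> is_f_grouplike odot))) /\
  (left_monoid_e_semigroup mul e odot \/ right_monoid_e_semigroup mul e odot ->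
      (left_identical mul e odot <-> exists f : T -> T, odot =2 f_mul mul f) /\
      (forall f : T -> T, odot =2 f_mul mul f -> f =1 left_e_map odot e)).
Proof.
split; [split | ].
- move=> [mulG [[_ mul1 _] odotA odote]]; split=> [idl | fG x y].
    apply: idempotent_f_mul_f_grouplike mulG odotA (identical_left_f_mul idl) _.
    by move=> x; apply: (idl e x).2.
  (* The compatibility axiom with both arguments [e]. *)
  have eee : odot e e = odot e (odot e e) by rewrite -odote mul1.
  by split=> //; apply: (f_grouplike_cubic_identity fG eee x y).1.
- move=> [mulG [[_ mul1 _] odotA odote]]; split=> [idr | fG x y].
    apply: idempotent_f_mul_f_grouplike mulG odotA (identical_right_f_mul idr) _.
    by move=> x; apply: (idr x e).2.
  have eee : odot e e = odot e (odot e e) by rewrite odotA -odote mul1.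
  by split=> //; apply: (f_grouplike_cubic_identity fG eee x y).2.
- move=> S_e; have mulM : is_monoid mul e by case: S_e => - [].
  split; last by move=> f odotE x; rewrite /left_e_map (f_mul_1l mulM odotE).
  split=> [idl | [f odotE] x y].
    by exists (left_e_map odot e); apply: identical_left_f_mul.
  have o1l := f_mul_1l mulM odotE; have o1r := f_mul_1r mulM odotE.
  (* Either axiom becomes [f (mul x y) = f (odot x y)], so [f] fixes every product [odot x y]. *)
  case: S_e => -[_ _ /(_ x y)]; rewrite ?o1l ?o1r => fE.
    by split=> //; rewrite -fE odotE.
  by split=> //; rewrite -fE odotE.
Qed.
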